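(* Let $f:\mathbb{X}\times\Xi\to\mathbb{R}^M$ be a bounded objective function and let $\boldsymbol{\eta}\in\mathbb{R}^M$ be a reference vector. Then, for any bounded multivariate risk functional $\boldsymbol{\rho}$ and any subset of inputs $X\subseteq\mathbb{X}$, the RTS front $$\mathcal{F}^{\mathrm{RTS}}_{\boldsymbol{\eta},f,\boldsymbol{\rho}}[X]:=\Bigl\{\boldsymbol{\eta}+\Bigl(\sup_{\mathbf{x}\in X}\max_{\mathbf{y}\in\boldsymbol{\rho}[f(\mathbf{x},\cdot)]}s^{\mathrm{Len}}_{(\boldsymbol{\eta},\boldsymbol{\lambda})}(\mathbf{y})\Bigr)\boldsymbol{\lambda}\in\mathbb{R}^M:\boldsymbol{\lambda}\in\mathcal{S}^{M-1}_+\Bigr\}$$ is either a Pareto front surface $$\mathcal{F}^{\mathrm{RTS}}_{\boldsymbol{\eta},f,\boldsymbol{\rho}}[X]=\mathcal{Y}^{\mathrm{int}}_{\boldsymbol{\eta}}\Bigl[\bigcup_{\mathbf{x}\in X}\boldsymbol{\rho}[f(\mathbf{x},\cdot)]\Bigr]=\mathcal{Y}^{\mathrm{int}}_{\boldsymbol{\eta}}\Bigl[\bigcup_{\mathbf{x}\in X}\mathcal{Y}^{\mathrm{int}}_{\boldsymbol{\eta}}[\boldsymbol{\rho}[f(\mathbf{x},\cdot)]]\Bigr]\in\mathbb{Y}^*_{\boldsymbol{\eta}},$$ or the singleton set $\mathcal{F}^{\mathrm{RTS}}_{\boldsymbol{\eta},f,\boldsymbol{\rho}}[X]=\{\bolds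ymbol{\eta}\}$.
   Context: $\mathbb{X}\subseteq\mathbb{R}^D$ is the input space and $\Xi\subseteq\mathbb{R}^W$ is the uncertain parameter space. Vectors in $\mathbb{R}^M$ have components $\mathbf{y}=(y^{(1)},\dots,y^{(M)})$. Orderings: $\mathbf{y}\succeq\mathbf{y}'$ iff $\mathbf{y}-\mathbf{y}'\in\mathbb{R}^M_{\ge0}$; $\mathbf{y}\succ\!\succ\mathbf{y}'$ (strong domination) iff $\mathbf{y}-\mathbf{y}'\in\mathbb{R}^M_{>0}$; $\preceq$ and $\prec\!\prec$ are the reverse relations. For a relation $\diamond$ and $A\subseteq\mathbb{R}^M$, $\mathbb{D}_\diamond[A]:=\bigcup_{\mathbf{a}\in A}\{\mathbf{y}\in\mathbb{R}^M:\mathbf{y}\diamond\mathbf{a}\}$. The weak Pareto front $\mathcal{Y}^{\mathrm{weak}}[A]$ is the set of $\mathbf{a}\in A$ such that no $\mathbf{a}'\in A$ satisfies $\mathbf{a}'\succ\!\succ\mathbf{a}$. Pareto front surface: for a bounded set $A\subset\mathbb{R}^M$ and $\boldsymbol{\eta}\in\mathbb{R}^M$, $\mathcal{Y}^{\mathrm{int}}_{\boldsymbol{\eta}}[A]:=\mathcal{Y}^{\mathrm{weak}}[\mathbb{D}_{\preceq}[\mathrm{Closure}(A)]]\cap\mathbb{D}_{\succ\!\succ}[\{\boldsymbol{\eta}\}]$. $\mathbb{Y}^*_{\boldsymbol{\eta}}$ denotes the set of all non-empty Pareto front surfaces with respect to $\boldsymbol{\eta}$, i.e. all non-empty sets of the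 form $\mathcal{Y}^{\mathrm{int}}_{\boldsymbol{\eta}}[A]$ with $A$ bounded. $\mathcal{S}^{M-1}_+:=\{\mathbf{y}\in\mathbb{R}^M_{>0}:\|\mathbf{y}\|_{L^2}=1\}$. The length scalarisation function is $s^{\mathrm{Len}}_{(\boldsymbol{\eta},\boldsymbol{\lambda})}(\mathbf{y})=\min_{m=1,\dots,M}\frac{\max(y^{(m)}-\eta^{(m)},0)}{\lambda^{(m)}}$. A multivariate risk functional $\boldsymbol{\rho}$ maps any vector-valued function $h:\Xi\to\mathbb{R}^M$ to a closed set $\boldsymbol{\rho}[h]\subseteq\mathbb{R}^M$. It is bounded if $\boldsymbol{\rho}[h]$ is a bounded set for every bounded $h:\Xi\to\mathbb{R}^M$. Here $f(\mathbf{x},\cdot)$ denotes the function $\boldsymbol{\xi}\mapsto f(\mathbf{x},\boldsymbol{\xi})$.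
   Formalization: The union of the risk sets ρ[f(x,·)] over x in X is additionally assumed bounded, as the Pareto front surface of this union requires; boundedness of f and ρ does not imply it, and the claim fails without it. *)

(* Defs.v *)
From HB Require Import structures.
From mathcomp Require Import all_boot all_order all_algebra.
From mathcomp Require Import all_classical all_reals all_analysis.

Set Implicit Arguments.
Unset Strict Implicit.
Unset Printing Implicit Defensive.

Import Order.TTheory GRing.Theory Num.Theory.
Import numFieldNormedType.Exports.

Local Open Scope classical_set_scope.
Local Open Scope ring_scope.

(* The objective space R^M is ['rV[R]_n.+1], with M = n.+1 >= 1.  The library
   norm on row vectors is the max norm: it has the same bounded sets and the
   same closures as the Euclidean norm. *)

Section Definitions.
Context {R : realType} {n : nat}.
Local Notation V := 'rV[R]_n.+1.
Implicit Types (y eta lambda : V) (A : set V).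

Definition weak_ge y y' : Prop := forall m, 0 <= (y - y') 0 m.
Definition strong_gt y y' : Prop := forall m, 0 < (y - y') 0 m.
Definition weak_le y y' : Prop := weak_ge y' y.

Definition dom_region (r : V -> V -> Prop) A : set V :=
  \bigcup_(a in A) [set y | r y a].

Definition weak_front A : set V :=
  [set a | A a /\ ~ exists2 a', A a' & strong_gt a' a].

(* Meant for bounded [A] only. *)
Definition front_surface eta A : set V :=
  weak_front (dom_region weak_le (closure A))
  `&` dom_region strong_gt [set eta].

Definition front_surfaces eta : set (set V) :=
  [set Y | Y !=set0 /\ exists2 A, bounded_set A & Y = front_surface eta A].

Definition norm2 y : R := Num.sqrt (\sum_m y 0 m ^+ 2).

Definition pos_sphere : set V :=
  [set lambda : V | (forall m, 0 < lambda 0 m) /\ norm2 lambda = 1].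

(* The index set is nonempty, so seeding the iterated minimum with the value
   at [ord0] gives the plain minimum. *)
Definition s_len eta lambda y : R :=
  let s m := Num.max (y 0 m - eta 0 m) 0 / lambda 0 m in
  \big[Num.min/s ord0]_(m < n.+1) s m.

(* The greatest element of [B], and 0 if there is none. *)
Definition set_max (B : set R) : R := xget 0 [set b | B b /\ ubound B b].

Record risk_functional (Xi : Type) := RiskFunctional {
  risk_fun :> (Xi -> V) -> set V;
  risk_closed : forall h : Xi -> V, closed (risk_fun h) }.

Definition bounded_risk (Xi : Type) (rho : risk_functional Xi) : Prop :=
  forall h : Xi -> V, bounded_set (range h) -> bounded_set (rho h).

(* The scalarised values are nonnegative, so suprema are taken in [0, +oo[ and
   the supremum (or maximum) of the empty set is 0; this is the library's
   value of [sup set0]. *)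
Definition rts_front (XX Xi : Type) (eta : V) (f : XX * Xi -> V)
    (rho : risk_functional Xi) (X : set XX) : set V :=
  [set eta + sup [set set_max (s_len eta lambda @` rho (fun xi => f (x, xi)))
                 | x in X] *: lambda
  | lambda in pos_sphere].

End Definitions.

(* Main.v *)
Require Import Defs.
From HB Require Import structures.
From mathcomp Require Import all_boot all_order all_algebra.
From mathcomp Require Import all_classical all_reals all_analysis.

Set Implicit Arguments.
Unset Strict Implicit.
Unset Printing Implicit Defensive.

Import Order.TTheory GRing.Theory Num.Theory.
Import numFieldNormedType.Exports.

Local Open Scope classical_set_scope.
Local Open Scope ring_scope.

(* For lambda on the positive sphere and t > 0, [t <= s_len eta lambda y] holds
   iff eta + t lambda is weakly dominated by y.  Hence, for a bounded set A with
   a point strongly above eta, the ray from eta in direction lambda lies in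
   the region dominated by closure(A) exactly up to t = sup_A s_len, and every
   point strongly above eta lies on one such ray: the front surface of A is the
   image of lambda |-> eta + (sup_A s_len) lambda.  Suprema over the union of
   the risk sets, and over the union of their front surfaces, both agree with
   the supremum of maxima in the RTS front.  If no point of the union is
   strongly above eta, every scalarised value is 0 and the front is {eta}. *)

Section FrontSurface.
Context {R : realType} {n : nat}.
Local Notation V := 'rV[R]_n.+1.
Implicit Types (a b y eta lambda : V) (A B K : set V) (t : R).

(** * Bounded sets and their closures *)

Lemma bounded_setP A :
  bounded_set A <-> exists M, forall a, A a -> `|a| <= M.
Proof.
split=> [[M [_ AM]]|[M AM]].
  by exists (M + 1) => a; apply: AM; rewrite ltrDl.
exists M; split=> [|x Mx a Aa]; first exact: num_real.
by rewrite /= (le_trans (AM a Aa))// ltW.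
Qed.

Lemma compact_closure_bounded A : bounded_set A -> compact (closure A).
Proof.
move=> /bounded_setP[M AM]; apply: bounded_closed_compact;
  last exact: closed_closure.
apply/bounded_setP; exists M.
have cM : closed [set a : V | `|a| <= M].
  apply: (preimage_closed _ (@closed_le _ M)) => x _.
  exact: norm_continuous.
by move=> a /(closureS AM); rewrite -(proj1 (closure_id _) cM).
Qed.

Lemma ler_coord_norm y m : `|y 0 m| <= `|y|.
Proof.
rewrite [leRHS]/Num.Def.normr /= mx_normrE.
by apply/bigmax_geP; right => /=; exists (0, m).
Qed.

(** Coordinates are bounded below by [eta] and above through [A]. This serves to bound a union of
    front surfaces. *)
Lemma bounded_between eta A B : bounded_set A ->
  (forall b, B b -> strong_gt b eta /\ exists2 a, A a & weak_le b a) ->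
  bounded_set B.
Proof.
move=> /bounded_setP[M AM] BA; apply/bounded_setP.
exists (Num.max `|eta| M) => b /BA[eb [a Aa ba]].
rewrite [leLHS]/Num.Def.normr /= mx_normrE; apply: bigmax_le => [|[i m] _ /=].
  by rewrite le_max normr_ge0.
have := eb m; have := ba m; rewrite !mxE (ord1 i) !subr_ge0 subr_gt0 => bam ebm.
rewrite ler_norml lerNl; apply/andP; split.
  apply: (@le_trans _ _ (- eta 0 m)); first by rewrite lerN2 ltW.
  by rewrite (le_trans (ler_norm _))// normrN le_max ler_coord_norm.
rewrite (le_trans bam)// (le_trans (ler_norm _))//.
by rewrite (le_trans (ler_coord_norm _ _))// le_max AM ?orbT.
Qed.

(** * The length scalarisation in a fixed positive direction *)

Section Scalarisation.
Variables (eta lambda : V).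
Hypothesis lambda_gt0 : forall m, 0 < lambda 0 m.
Local Notation s := (s_len eta lambda).

Lemma s_len_geP t y : t <= s y <->
  forall m, t <= Num.max (y 0 m - eta 0 m) 0 / lambda 0 m.
Proof.
split=> [/bigmin_geP[_ +] m|ty]; first exact.
by apply/bigmin_geP; split=> [|m _]; exact: ty.
Qed.

Lemma s_len_ge0 y : 0 <= s y.
Proof.
by apply/s_len_geP => m; rewrite divr_ge0 ?le_max ?lexx ?orbT// ltW.
Qed.

(** Since [t * lambda 0 m] is positive, it cannot lie below the 0 of the truncation, so it lies
    below [y 0 m - eta 0 m]. At [t = 0] the left side always holds and the equivalence fails. *)
Lemma s_len_ge_ray t y : 0 < t -> t <= s y <-> weak_le (eta + t *: lambda) y.
Proof.
move=> t0; split=> [/s_len_geP ty m|ty].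
  have := ty m; rewrite ler_pdivlMr// le_max !mxE opprD addrA subr_ge0.
  by case/orP=> // /(lt_le_trans (mulr_gt0 t0 (lambda_gt0 m))); rewrite ltxx.
apply/s_len_geP => m; rewrite ler_pdivlMr// le_max.
by have := ty m; rewrite !mxE opprD addrA subr_ge0 => ->.
Qed.

Lemma s_len_gt0 y : strong_gt y eta -> 0 < s y.
Proof.
move=> ye; apply/bigmin_gtP; split=> [|m _].
  by rewrite divr_gt0// lt_max; have := ye ord0; rewrite !mxE => ->.
by rewrite divr_gt0// lt_max; have := ye m; rewrite !mxE => ->.
Qed.

Lemma s_len_eq0 y : ~ strong_gt y eta -> s y = 0.
Proof.
move=> /existsNP[m /negP]; rewrite !mxE -leNgt => ym.
apply/eqP; rewrite eq_le s_len_ge0 andbT.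
apply: (le_trans (bigmin_le_cond _ (j := m) _ _)) => //.
by rewrite (max_idPr ym) mul0r.
Qed.

Lemma s_len_mono a b : weak_le a b -> s a <= s b.
Proof.
move=> ab; apply/s_len_geP => m.
have /s_len_geP /(_ m) sam : s a <= s a by [].
apply: (le_trans sam); rewrite ler_pM2r ?invr_gt0//.
have := ab m; rewrite !mxE subr_ge0 => abm.
by rewrite ge_max !le_max lexx orbT andbT lerD2r abm.
Qed.

Lemma continuous_s_len : continuous s.
Proof.
pose F m y := Num.max (y 0 m - eta 0 m) 0 / lambda 0 m.
have cF m : continuous (F m).
  move=> y; have c1 : {for y, continuous (fun y : V => y 0 m - eta 0 m : R^o)}.
    by apply: continuousB; [exact: coord_continuous | exact: cst_continuous].
  have c2 := continuous_max c1 (@cst_continuous _ _ (0 : R^o) y).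
  exact: (continuousM c2 (@cst_continuous _ _ (lambda 0 m)^-1 y)).
(* Induction on the list of indices; the seed of the iterated minimum is the base case. *)
rewrite /s_len; elim: (index_enum _) => [|m r IH] y.
  by under eq_fun do rewrite big_nil; exact: cF.
under eq_fun do rewrite big_cons.
exact: (@continuous_min _ _ (F m : V -> R^o) _ y (cF m y) (IH y)).
Qed.

Lemma s_len_max K : K !=set0 -> compact K ->
  exists2 c, K c & forall y, K y -> s y <= s c.
Proof.
move=> K0 cK.
have [c cK1 cmax] := EVT_max_rV K0 cK (continuous_subspaceT continuous_s_len).
by exists c; [rewrite inE in cK1 | move=> y Ky; apply: cmax; rewrite inE].
Qed.

Lemma has_ubound_s_len A : bounded_set A -> has_ubound (s @` A).
Proof.
move=> bA; have [->|/set0P[a Aa]] := eqVneq A set0.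
  by rewrite image_set0; exists 0.
have [|c _ cmax] := s_len_max _ (compact_closure_bounded bA).
  by exists a; exact: subset_closure.
by exists (s c) => _ [y Ay <-]; apply: cmax; exact: subset_closure.
Qed.

(** By attainment, [set_max] is here a genuine maximum and not its default 0. *)
Lemma set_max_s_len K : K !=set0 -> compact K ->
  exists2 c, K c /\ set_max (s @` K) = s c & forall y, K y -> s y <= s c.
Proof.
move=> K0 cK; have [c Kc cmax] := s_len_max K0 cK.
exists c => //; split=> //; apply: xget_unique.
  by split; [exists c | move=> _ [y Ky <-]; exact: cmax].
move=> _ [[y Ky <-] ymax]; apply/eqP; rewrite eq_le cmax//=.
by apply: ymax; exists c.
Qed.

Lemma set_max_s_len0 : set_max (s @` set0) = 0.
Proof. by rewrite image_set0; apply: xgetPN => b []. Qed.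

(* Since [s] is continuous, its maximum over the compact set [closure A] is
   the supremum over [A]. *)
Lemma dom_region_ray A t : A !=set0 -> bounded_set A -> 0 < t ->
  dom_region weak_le (closure A) (eta + t *: lambda) <-> t <= sup (s @` A).
Proof.
move=> A0 bA t0; split=> [[a cAa ta]|tA].
  have /le_trans := (s_len_ge_ray a t0).2 ta; apply.
  have cM : closed [set y | s y <= sup (s @` A)].
    apply: (preimage_closed _ (@closed_le _ (sup (s @` A)))) => x _.
    exact: continuous_s_len.
  suff /closureS : A `<=` [set y | s y <= sup (s @` A)].
    by rewrite -(proj1 (closure_id _) cM); exact.
  by move=> y Ay; apply: ub_le_sup; [exact: has_ubound_s_len | exists y].
have cA0 : closure A !=set0 by case: A0 => a Aa; exists a; exact: subset_closure.
have [c cAc cmax] := s_len_max cA0 (compact_closure_bounded bA).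
exists c => //; apply/s_len_ge_ray => //; apply: (le_trans tA).
apply: ge_sup; first by case: A0 => a Aa; exists (s a), a.
by move=> _ [y Ay <-]; apply: cmax; exact: subset_closure.
Qed.

Lemma s_len_ray t : 0 <= t -> s (eta + t *: lambda) = t.
Proof.
move=> t0; have E m :
    Num.max ((eta + t *: lambda) 0 m - eta 0 m) 0 / lambda 0 m = t.
  rewrite !mxE addrAC subrr add0r (max_idPl _) ?mulr_ge0 ?(ltW (lambda_gt0 m))//.
  by rewrite mulfK// gt_eqF.
apply/eqP; rewrite eq_le; apply/andP; split; last first.
  by apply/s_len_geP => m; rewrite E.
have /s_len_geP /(_ ord0) : s (eta + t *: lambda) <= s (eta + t *: lambda) by [].
by rewrite E.
Qed.

Lemma sup_s_len_gt0 A a : bounded_set A -> A a -> strong_gt a eta ->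
  0 < sup (s @` A).
Proof.
move=> bA Aa ae; apply: (lt_le_trans (s_len_gt0 ae)).
by apply: ub_le_sup; [exact: has_ubound_s_len | exists a].
Qed.

End Scalarisation.

(** * Rays from the reference point and the polar form of the front surface *)

Lemma strong_gtP y eta : dom_region strong_gt [set eta] y <-> strong_gt y eta.
Proof. by split=> [[_ -> //]|ye]; exists eta. Qed.

Lemma strong_gt_ray eta lambda t : (forall m, 0 < lambda 0 m) -> 0 < t ->
  strong_gt (eta + t *: lambda) eta.
Proof. by move=> l0 t0 m; rewrite !mxE addrAC subrr add0r mulr_gt0. Qed.

Lemma strong_gt_rayP y eta : strong_gt y eta ->
  exists lambda t, [/\ pos_sphere lambda, 0 < t & y = eta + t *: lambda].
Proof.
move=> ye; set N := norm2 (y - eta).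
have S0 : 0 < \sum_m (y - eta) 0 m ^+ 2.
  rewrite (bigD1 ord0)//= ltr_wpDr ?exprn_gt0 ?ye// sumr_ge0// => m _.
  exact: sqr_ge0.
have N0 : 0 < N by rewrite sqrtr_gt0.
exists (N^-1 *: (y - eta)), N; split=> //; last first.
  by rewrite scalerA divff ?gt_eqF// scale1r addrC subrK.
split=> [m|]; first by rewrite mxE mulr_gt0 ?invr_gt0.
rewrite /norm2 (eq_bigr (fun m => N^-1 ^+ 2 * (y - eta) 0 m ^+ 2)); last first.
  by move=> m _; rewrite mxE exprMn.
rewrite -mulr_sumr sqrtrM ?sqr_ge0// sqrtr_sqr ger0_norm ?invr_ge0 ?ltW//.
by rewrite -/(norm2 _) -/N mulVf// gt_eqF.
Qed.

Lemma pos_sphere_neq0 : @pos_sphere R n !=set0.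
Proof.
have [|lambda [t [? _ _]]] := @strong_gt_rayP (const_mx 1) 0;
  last by exists lambda.
by move=> m; rewrite !mxE subr0.
Qed.

(** The length scalarisation with reference [a] instead of [eta] measures how far one can move from
    [a] along [lambda] while staying below [a']. *)
Lemma strong_gt_slack a' a lambda : (forall m, 0 < lambda 0 m) ->
  strong_gt a' a -> exists2 e, 0 < e & weak_le (a + e *: lambda) a'.
Proof.
move=> l0 aa; exists (s_len a lambda a'); first exact: s_len_gt0.
by apply/s_len_ge_ray => //; exact: s_len_gt0.
Qed.

(** The point [a] makes the supremum positive in every direction, so [dom_region_ray] applies at the
    supremum itself. *)
Lemma front_surfaceE eta A a : bounded_set A -> A a -> strong_gt a eta ->
  front_surface eta A =
  [set eta + sup (s_len eta lambda @` A) *: lambda | lambda in pos_sphere].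
Proof.
move=> bA Aa ae; have A0 : A !=set0 by exists a.
apply/seteqP; split=> [y [[yD ymax] /strong_gtP ye]|_ [lambda sl <-]].
  have [lambda [t [sl t0 yE]]] := strong_gt_rayP ye.
  exists lambda => //; have l0 := sl.1; rewrite yE; congr (_ + _ *: _).
  have L0 := sup_s_len_gt0 l0 bA Aa ae.
  apply/eqP; rewrite eq_le; apply/andP; split; last first.
    by apply/(dom_region_ray eta l0 A0 bA t0); rewrite -yE.
  (* Otherwise the exit point of the same ray would strongly dominate [y]. *)
  rewrite leNgt; apply/negP => tL; apply: ymax.
  exists (eta + sup (s_len eta lambda @` A) *: lambda).
    exact/(dom_region_ray eta l0 A0 bA L0).
  by move=> m; rewrite yE !mxE subr_gt0 ltrD2l ltr_pM2r.
have l0 := sl.1; have L0 := sup_s_len_gt0 l0 bA Aa ae.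
split; last by apply/strong_gtP; exact: strong_gt_ray.
split; first exact/(dom_region_ray eta l0 A0 bA L0).
move=> [z [c cAc zc] /(strong_gt_slack l0)[e e0 ez]].
(* A strongly dominating [z] leaves slack [e], which would push the ray past its exit parameter. *)
have /(dom_region_ray eta l0 A0 bA) : dom_region weak_le (closure A)
    (eta + (sup (s_len eta lambda @` A) + e) *: lambda).
  exists c => // m; have := zc m; have := ez m.
  rewrite !mxE !subr_ge0 mulrDl addrA; exact: le_trans.
by move=> /(_ (addr_gt0 L0 e0)); rewrite gerDl leNgt e0.
Qed.

Lemma front_surface_between eta A b : closed A -> front_surface eta A b ->
  strong_gt b eta /\ exists2 a, A a & weak_le b a.
Proof.
move=> /closure_id AE [[[a cAa ba] _] /strong_gtP be].
by split=> //; exists a; rewrite // AE.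
Qed.

End FrontSurface.

(** * Suprema over a union of closed sets *)

Section Union.
Context {R : realType} {n : nat} {I : Type}.
Local Notation V := 'rV[R]_n.+1.
Variables (eta : V) (X : set I) (A : I -> set V).
Hypothesis closedA : forall x, closed (A x).
Hypothesis boundedU : bounded_set (\bigcup_(x in X) A x).

Lemma bounded_bigcup_part x : X x -> bounded_set (A x).
Proof.
move=> Xx; have /bounded_setP[M UM] := boundedU.
by apply/bounded_setP; exists M => a Aa; apply: UM; exists x.
Qed.

Lemma compact_bigcup_part x : X x -> compact (A x).
Proof. by move=> /bounded_bigcup_part bA; exact: bounded_closed_compact. Qed.

Lemma bounded_bigcup_front :
  bounded_set (\bigcup_(x in X) front_surface eta (A x)).
Proof.
apply: (bounded_between (eta := eta) boundedU) => b [x Xx].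
move=> /(front_surface_between (@closedA x))[be [a Aa ba]].
by split=> //; exists a => //; exists x.
Qed.

Section Scalarisation.
Variable lambda : V.
Hypothesis lambda_gt0 : forall m, 0 < lambda 0 m.
Local Notation s := (s_len eta lambda).

Lemma sup_set_max_eq0 :
  (forall a, (\bigcup_(x in X) A x) a -> ~ strong_gt a eta) ->
  sup [set set_max (s @` A x) | x in X] = 0.
Proof.
move=> Ueta; have : [set set_max (s @` A x) | x in X] `<=` [set 0].
  move=> _ [x Xx <-]; have [->|/set0P A0] := eqVneq (A x) set0.
    exact: set_max_s_len0.
  have [c [Ac ->] _] := set_max_s_len eta lambda A0 (compact_bigcup_part Xx).
  by apply: s_len_eq0 => //; apply: Ueta; exists x.
(* The set of maxima is empty when [X] is, and then the supremum is 0 by convention. *)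
by move=> /subset_set1[] ->; rewrite ?sup0 ?sup1.
Qed.

Lemma sup_set_max_bigcup : \bigcup_(x in X) A x !=set0 ->
  sup [set set_max (s @` A x) | x in X] = sup (s @` \bigcup_(x in X) A x).
Proof.
case=> a Ua; have [x0 Xx0 Aa] := Ua.
have [M UM] := has_ubound_s_len eta lambda boundedU.
have maxd : [set set_max (s @` A x) | x in X] `<=`
    down (s @` \bigcup_(x in X) A x).
  move=> _ [x Xx <-]; apply/downP.
  have [->|/set0P A0] := eqVneq (A x) set0.
    (* An empty part contributes the default 0, which any scalarised value dominates. *)
    by exists (s a); [exists a | rewrite set_max_s_len0 s_len_ge0].
  have [c [Ac ->] _] := set_max_s_len eta lambda A0 (compact_bigcup_part Xx).
  by exists (s c) => //; exists c => //; exists x.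
apply/eqP; rewrite eq_le; apply/andP; split; apply: sup_le => //.
- by exists (set_max (s @` A x0)), x0.
- by split; [exists (s a), a | exists M].
- move=> _ [y [x Xx Ay] <-]; apply/downP.
  exists (set_max (s @` A x)); first by exists x.
  have A0 : A x !=set0 by exists y.
  have [c [_ ->] cmax] := set_max_s_len eta lambda A0 (compact_bigcup_part Xx).
  exact: cmax.
- by exists (s a), a.
split; first by exists (set_max (s @` A x0)), x0.
by exists M => r /maxd/downP[v /UM vM rv]; exact: le_trans rv vM.
Qed.

(** A surface point lies weakly below a point of its part. Conversely, a point strongly above [eta]
    scores at most as much as the point where the ray along [lambda] meets the surface of its part;
    all other points score 0. *)
Lemma sup_front_bigcup a : pos_sphere lambda ->
  (\bigcup_(x in X) A x) a -> strong_gt a eta ->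
  sup (s @` \bigcup_(x in X) front_surface eta (A x)) =
  sup (s @` \bigcup_(x in X) A x).
Proof.
move=> sl Ua ae.
have below x y : X x -> A x y -> strong_gt y eta ->
    exists2 b, (\bigcup_(x in X) front_surface eta (A x)) b & s y <= s b.
  move=> Xx Ay ye; have bA := bounded_bigcup_part Xx.
  exists (eta + sup (s @` A x) *: lambda).
    by exists x => //; rewrite (front_surfaceE bA Ay ye); exists lambda.
  rewrite s_len_ray//; last exact/ltW/(sup_s_len_gt0 lambda_gt0 bA Ay ye).
  by apply: ub_le_sup; [exact: has_ubound_s_len | exists y].
have [x0 Xx0 Aa] := Ua; have [b0 Bb0 ab0] := below x0 a Xx0 Aa ae.
apply/eqP; rewrite eq_le; apply/andP; split; apply: sup_le => //.
- move=> _ [b [x Xx Bb] <-]; apply/downP.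
  have [be [c Ac bc]] := front_surface_between (@closedA x) Bb.
  by exists (s c); [exists c => //; exists x | exact: s_len_mono].
- by exists (s b0), b0.
- by split; [exists (s a), a | exact: has_ubound_s_len].
- move=> _ [y [x Xx Ay] <-]; apply/downP.
  have [ye|/s_len_eq0 -> //] := pselect (strong_gt y eta).
    by have [b Bb yb] := below x y Xx Ay ye; exists (s b) => //; exists b.
  by exists (s b0); [exists b0 | exact: s_len_ge0].
- by exists (s a), a.
split; first by exists (s b0), b0.
exact: (has_ubound_s_len _ _ bounded_bigcup_front).
Qed.

End Scalarisation.

End Union.

(* The last hypothesis makes the front surface of the union well defined: such
   surfaces are defined for bounded sets only, and boundedness of [rho] at each
   [f (x, .)] separately does not bound the union over [x] in [X]. *)
Theorem proposition4p2 (R : realType) (D W n : nat)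
    (XX : set 'rV[R]_D) (Xi : set 'rV[R]_W)
    (f : XX * Xi -> 'rV[R]_n.+1) (f_bounded : bounded_set (range f))
    (eta : 'rV[R]_n.+1)
    (rho : risk_functional Xi) (rho_bounded : bounded_risk rho)
    (X : set XX)
    (union_bounded :
       bounded_set (\bigcup_(x in X) rho (fun xi => f (x, xi)))) :
  let F := rts_front eta f rho X in
  [/\ F = front_surface eta (\bigcup_(x in X) rho (fun xi => f (x, xi))),
      F = front_surface eta
            (\bigcup_(x in X) front_surface eta (rho (fun xi => f (x, xi)))) &
      front_surfaces eta F]
  \/ F = [set eta].
Proof.
set A := fun x : XX => rho (fun xi => f (x, xi)).
have cA x : closed (A x) by exact: risk_closed.
have bU : bounded_set (\bigcup_(x in X) A x) by [].
move=> F; have [[a Ua ae]|noU] :=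
  pselect (exists2 a, (\bigcup_(x in X) A x) a & strong_gt a eta); [left|right].
  have FE : F = front_surface eta (\bigcup_(x in X) A x).
    rewrite (front_surfaceE bU Ua ae); apply: eq_imagel => lambda sl.
    by rewrite (sup_set_max_bigcup eta cA bU sl.1)//; exists a.
  have F0 : F !=set0.
    by have [lambda sl] := @pos_sphere_neq0 R n; eexists; exists lambda.
  split=> //; last by split=> //; exists (\bigcup_(x in X) A x).
  have [x0 Xx0 Aa] := Ua.
  (* To apply [front_surfaceE] to the union of surfaces, that union too needs a point strongly above
     [eta]; the part containing [a] supplies it. *)
  have [b Bb] : front_surface eta (A x0) !=set0.
    rewrite (front_surfaceE (bounded_bigcup_part bU Xx0) Aa ae).
    by have [lambda sl] := @pos_sphere_neq0 R n; eexists; exists lambda.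
  have be := (front_surface_between (cA x0) Bb).1.
  have UBb : (\bigcup_(x in X) front_surface eta (A x)) b by exists x0.
  rewrite (front_surfaceE (bounded_bigcup_front eta cA bU) UBb be) FE.
  rewrite (front_surfaceE bU Ua ae); apply: eq_imagel => lambda sl.
  by rewrite (sup_front_bigcup cA bU sl.1 sl Ua ae).
have E lambda : pos_sphere lambda ->
    eta + sup [set set_max (s_len eta lambda @` A x) | x in X] *: lambda = eta.
  move=> sl; rewrite (sup_set_max_eq0 cA bU sl.1) ?scale0r ?addr0// => a Ua ae.
  by apply: noU; exists a.
apply/seteqP; split=> [_ [lambda sl <-]|_ ->]; first exact: E.
(* Some direction must exist for [eta] to belong to the image. *)
by have [lambda sl] := @pos_sphere_neq0 R n; exists lambda => //; exact: E.
Qed.
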